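(* Let $\beta\geq\frac{1+\sqrt5}{2}$ and let $\mathrm{d}_{-\beta}(l_\beta)=d_1d_2\cdots d_m0^\omega$ with $m\geq1$ and $d_m\neq0$; set $d_j=0$ for $j>m$. Suppose $0<d_i$ and $d_1>d_{2i}$ for all $i=1,2,\dots,m$. Define \[ \Delta_0=1,\qquad \Delta_k=\Big|(-1)^k+\sum_{i=1}^\infty\frac{d_{k-1+i}-d_{k+i}}{(-\beta)^i}\Big|\ \ (k=1,\dots,m-1),\qquad \Delta_m=\begin{cases}1-\frac{d_m}{\beta} & m\text{ even},\\ \frac{d_m}{\beta} & m\text{ odd},\end{cases} \] \[ \Delta_{m+1}=\begin{cases}\Delta_0 & m\text{ even},\ d_m<d_1-1,\\ \Delta_1 & m\text{ even},\ d_m=d_1-1,\\ \Delta_0 & m\text{ odd},\end{cases}\qquad \Delta_k=\begin{cases}\Delta_0 & \text{odd } k\geq m+2,\\ \Delta_1 & \text{even } k\geq m+2.\end{cases} \] Then the distance between any two consecutive elements of $\mathbb{Z}_{-\beta}$ belongs to $\{\Delta_k: k\geq0\}$, and all such distances are less than $2$.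
   Context: Let $\beta>1$, $\mathcal{A}_\beta=\{0,1,\dots,\lfloor\beta\rfloor\}$, $l_\beta=\frac{-\beta}{\beta+1}$, $r_\beta=\frac1{\beta+1}$, $I_\beta=[l_\beta,r_\beta)$, $T_{-\beta}(x)=-\beta x-\lfloor -\beta x+\frac{\beta}{\beta+1}\rfloor$ on $I_\beta$. The $(-\beta)$-expansion of $x\in I_\beta$ is $\mathrm{d}_{-\beta}(x)=x_1x_2\cdots$ with $x_i=\lfloor -\beta T_{-\beta}^{i-1}(x)+\frac{\beta}{\beta+1}\rfloor$. An infinite string over $\mathcal{A}_\beta$ is $(-\beta)$-admissible if it is $\mathrm{d}_{-\beta}(x)$ for some $x\in I_\beta$. For a finite string $a_k\cdots a_0$ over $\mathcal{A}_\beta$, $\gamma(a_k\cdots a_0)=\sum_{i=0}^ka_i(-\beta)^i$. $\mathbb{Z}_{-\beta}=\{\gamma(a_k\cdots a_0): a_k\cdots a_00^\omega\text{ is admissible}\}$, where $0^\omega$ is the infinite repetition of $0$. *)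

(* Defs.v *)
From mathcomp Require Import all_boot all_order all_algebra.
From mathcomp Require Import all_classical all_reals all_analysis.

Set Implicit Arguments.
Unset Strict Implicit.
Unset Printing Implicit Defensive.

Import Order.TTheory GRing.Theory Num.Theory.
Import numFieldNormedType.Exports.

Local Open Scope classical_set_scope.
Local Open Scope ring_scope.

Definition lbeta {R : realType} (beta : R) : R := - beta / (beta + 1).

Definition rbeta {R : realType} (beta : R) : R := 1 / (beta + 1).

Definition Ibeta {R : realType} (beta : R) : set R :=
  [set x | lbeta beta <= x < rbeta beta].

(* [digit beta x] is the integer subtracted in the transformation; the map is
   total on R, but it is only ever iterated from points of [Ibeta], which it
   preserves. *)
Definition digit {R : realType} (beta x : R) : int :=
  Num.floor (- beta * x + beta / (beta + 1)).

Definition Tneg {R : realType} (beta x : R) : R :=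
  - beta * x - (digit beta x)%:~R.

(* Infinite strings are functions [nat -> int] indexed from 0, so that
   [expansion beta x i] is the digit x_(i+1). *)
Definition expansion {R : realType} (beta x : R) : nat -> int :=
  fun i => digit beta (iter i (Tneg beta) x).

Definition alphabet {R : realType} (beta : R) : set int :=
  [set a | 0 <= a <= Num.floor beta].

Definition admissible {R : realType} (beta : R) (u : nat -> int) : Prop :=
  (forall i, alphabet beta (u i)) /\
  exists2 x, Ibeta beta x & u = expansion beta x.

(* A finite string a_k ... a_0 is the sequence [:: a_k; ...; a_0]. *)
Definition gamma {R : realType} (beta : R) (a : seq int) : R :=
  \sum_(i < size a) (nth 0 (rev a) i)%:~R * (- beta) ^+ i.

(* The infinite string a 0^omega. *)
Definition pad0 (a : seq int) : nat -> int := fun i => nth 0 a i.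

Definition Zneg {R : realType} (beta : R) : set R :=
  [set z | exists a : seq int,
     [/\ a != [::], admissible beta (pad0 a) & z = gamma beta a]].

Definition consecutive {R : realType} (Z : set R) (x y : R) : Prop :=
  [/\ Z x, Z y, x < y & forall z, Z z -> ~ (x < z < y)].

(* In the two definitions below [d] is indexed from 1: [d 0] is never used. *)

(* Delta_k for k <= m; this covers Delta_1 = Delta_m when m = 1. *)
Definition Delta_init {R : realType} (beta : R) (m : nat) (d : nat -> int)
    (k : nat) : R :=
  if k == 0%N then 1
  else if (k < m)%N then
    `| (-1) ^+ k
       + \big[+%R/0]_(1 <= i <oo)
           ((d (k - 1 + i)%N - d (k + i)%N)%:~R / (- beta) ^+ i) |
  else if odd m then (d m)%:~R / beta else 1 - (d m)%:~R / beta.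

(* In the case k = m + 1, m even, [d m <= d 1 - 1] is expected, so that the last
   alternative is [d m = d 1 - 1]. *)
Definition Delta {R : realType} (beta : R) (m : nat) (d : nat -> int)
    (k : nat) : R :=
  let D := Delta_init beta m d in
  if (k <= m)%N then D k
  else if k == m.+1 then
    if odd m then D 0%N
    else if d m < d 1%N - 1 then D 0%N else D 1%N
  else if odd k then D 0%N else D 1%N.

(* Main.v *)
Require Import Defs.
From mathcomp Require Import all_boot all_order all_algebra.
From mathcomp Require Import all_classical all_reals all_analysis.
From mathcomp Require Import zify ring lra.
Import Order.TTheory GRing.Theory Num.Theory.
Import numFieldNormedType.Exports.
Local Open Scope classical_set_scope.
Local Open Scope ring_scope.

(** Every real t has a fractional part F(t) in [l, r), the eventual value of
    T^n (t / (-beta)^n), and Z_{-beta} is the zero set of F, while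
    F(-beta t) = T(F(t)).  On an interval [a, b] between suitable zeros F is
    t - a up to the value r, possibly t - a - 1 from l up to some T^o(l) with o
    odd, and finally t - b from some T^e(l) with e even, where o and e differ by
    one; such an interval has length 1 or 1 + T^o(l) - T^e(l), i.e. Delta_k with
    k = max(o, e).  Multiplication by -beta turns the interval of index k into
    a row of unit intervals, intervals of index 1 and one of index k + 1:
    the hypotheses 0 < d_i and d_{2i} < d_1 say that T^k(l) < 0 for k < m and
    that the pieces of F arising in this way do not degenerate.  For beta at
    least the golden ratio [0, 1] is a unit interval, and its images under the
    powers of -beta cover the line.  For m odd the interval of index m contains
    one more zero, a + 1, which gives the distances 1 and Delta_m = d_m / beta. *)

(** * The transformation, its digits, and the fractional part it defines *)

Section Transformation.
Context (R : realType) (beta : R).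
Hypothesis beta_gt1 : 1 < beta.

Local Notation l := (lbeta beta).
Local Notation r := (rbeta beta).
Local Notation T := (Tneg beta).

Lemma lbetaE : l = r - 1.
Proof. rewrite /lbeta /rbeta; field; apply/eqP => h; have := beta_gt1; lra. Qed.

Lemma rbeta_gt0 : 0 < r.
Proof. by rewrite /rbeta divr_gt0 //; have := beta_gt1; lra. Qed.

Lemma mul_rbeta : beta * r = 1 - r.
Proof. rewrite /rbeta; field; apply/eqP => h; have := beta_gt1; lra. Qed.

Lemma rbeta_lt1 : r < 1.
Proof.
have := mul_rbeta; have : 0 < beta * r.
  by rewrite mulr_gt0 ?rbeta_gt0 //; have := beta_gt1; lra.
by lra.
Qed.

Lemma digit_eq (x : R) (k : int) :
  l <= - beta * x - k%:~R < r -> digit beta x = k.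
Proof.
move=> /andP[h1 h2]; apply: floor_def; rewrite intrD.
have -> : beta / (beta + 1) = - l by rewrite /lbeta mulNr opprK.
by have := lbetaE => ?; apply/andP; split; lra.
Qed.

Lemma Tneg_eq (x : R) (k : int) :
  l <= - beta * x - k%:~R < r -> T x = - beta * x - k%:~R.
Proof. by move=> /digit_eq h; rewrite /Tneg h. Qed.

Lemma Tneg_bounds (x : R) : l <= T x < r.
Proof.
have := floor_itv (- beta * x + beta / (beta + 1)); rewrite -/(digit beta x) intrD.
have -> : beta / (beta + 1) = - l by rewrite /lbeta mulNr opprK.
by rewrite /Tneg; have := lbetaE => h /andP[h1 h2]; apply/andP; split; lra.
Qed.

Lemma iter_Tneg_bounds (n : nat) (x : R) :
  l <= x < r -> l <= iter n T x < r.
Proof. by case: n => [//|n] _; exact: Tneg_bounds. Qed.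

Lemma digit0 : digit beta 0 = 0.
Proof.
apply: digit_eq; have := rbeta_gt0; have := rbeta_lt1; have := lbetaE.
by move=> *; apply/andP; split; lra.
Qed.

Lemma Tneg0 : T 0 = 0.
Proof. by rewrite /Tneg digit0; lra. Qed.

Lemma iter_Tneg0 (n : nat) : iter n T 0 = 0.
Proof. by elim: n => //= n ->; rewrite Tneg0. Qed.

(** The argument of the floor is [- beta * x - l], which runs over (0, beta] because
    [beta * r = - l]. *)
Lemma digit_alphabet (x : R) : l <= x < r -> alphabet beta (digit beta x).
Proof.
move=> /andP[h1 h2]; rewrite /alphabet /=.
have b0 : 0 < beta by have := beta_gt1; lra.
have h3 : beta * l <= beta * x by rewrite ler_pM2l.
have h4 : beta * x < beta * r by rewrite ltr_pM2l.
have e : beta / (beta + 1) = - l by rewrite /lbeta mulNr opprK.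
have := lbetaE; have := mul_rbeta => e1 e2.
have e3 : beta * l = beta * r - beta by rewrite e2 mulrBr mulr1.
apply/andP; split.
  by rewrite /digit e floor_ge0; lra.
by rewrite /digit; apply: le_floor; rewrite e; lra.
Qed.

(** Bernoulli's inequality. The bound covers all large exponents, so that a later use can prescribe
    the parity. *)
Lemma exists_expr_gt (C : R) : exists n, forall k, (n <= k)%N -> C < beta ^+ k.
Proof.
have bern n : 1 + n%:R * (beta - 1) <= beta ^+ n.
  elim: n => [|n ih]; first by rewrite mul0r addr0 expr0.
  rewrite exprS; have b0 : 0 < beta by have := beta_gt1; lra.
  have : beta * (1 + n%:R * (beta - 1)) <= beta * beta ^+ n by rewrite ler_pM2l.
  apply: le_trans; rewrite -natr1.
  have : 0 <= n%:R * ((beta - 1) * (beta - 1)).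
    by rewrite mulr_ge0 // mulr_ge0 //; have := beta_gt1; lra.
  by lra.
have d0 : 0 < beta - 1 by have := beta_gt1; lra.
exists (Num.bound (C / (beta - 1))) => k hk; apply: lt_le_trans (bern k).
have : C / (beta - 1) < k%:R.
  apply: le_lt_trans (ler_norm _) _.
  have := archi_boundP (normr_ge0 (C / (beta - 1))).
  by rewrite /Num.bound normr_id => h; apply: lt_le_trans h _; rewrite ler_nat.
by rewrite ltr_pdivrMr // => ?; lra.
Qed.

(** With zero digits the orbit is (-beta)^j x, which leaves every bounded interval unless x = 0. *)
Lemma eq0_of_digits0 (x : R) :
  l <= x < r -> (forall j, digit beta (iter j T x) = 0) -> x = 0.
Proof.
move=> hx h.
have e j : iter j T x = (- beta) ^+ j * x.
  elim: j => [|j ih]; first by rewrite expr0 mul1r.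
  by rewrite iterS /Tneg h subr0 ih exprS mulrA.
apply/eqP/negPn/negP => x0.
have x1 : 0 < `|x| by rewrite normr_gt0.
have [n /(_ n (leqnn n)) hn] := exists_expr_gt (1 / `|x|).
have := iter_Tneg_bounds n _ hx; rewrite e => /andP[h1 h2].
have : `|(- beta) ^+ n * x| <= 1.
  rewrite ler_norml; have := lbetaE; have := rbeta_lt1; have := rbeta_gt0.
  by move=> *; apply/andP; split; lra.
have b0 : 0 < beta by have := beta_gt1; lra.
rewrite normrM normrX normrN (gtr0_norm b0).
by rewrite leNgt -ltr_pdivrMr // hn.
Qed.

(* [frac_part t v]: [v] is the value of T^n at t / (-beta)^n once this point
   lies in the open interval, where the value no longer depends on [n]; the
   left endpoint of the interval is excluded because r does not belong to it. *)
Definition frac_part (t v : R) : Prop :=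
  exists n, l < t / (- beta) ^+ n < r /\ iter n T (t / (- beta) ^+ n) = v.

(** Since [l = - beta * r], division by -beta maps (l, r) into itself, and the quotient has digit 0,
    so T undoes the division. *)
Lemma frac_part_shift (n j : nat) (t : R) (x := t / (- beta) ^+ n)
    (y := t / (- beta) ^+ (n + j)) :
  l < x < r -> l < y < r /\ iter (n + j) T y = iter n T x.
Proof.
have b0 : 0 < beta by have := beta_gt1; lra.
elim: j @y => [|j ih] /= hx; first by rewrite addn0.
have [/andP[h1 h2] <-] := ih hx; rewrite addnS.
set y := t / (- beta) ^+ (n + j) in h1 h2 *.
have -> : t / (- beta) ^+ (n + j).+1 = - (y / beta).
  by rewrite /y exprSr invfM [(- beta)^-1]invrN !mulrN mulrA.
have e : beta * (y / beta) = y by field; rewrite gt_eqF.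
have := lbetaE; have := mul_rbeta; have := rbeta_gt0; have := rbeta_lt1.
move=> e1 e2 e3 e4.
have k1 : beta * (- (y / beta)) < beta * r by lra.
have k3 : beta * l < beta * - (y / beta).
  by rewrite e4 mulrBr mulr1 e3; have := beta_gt1; lra.
split; first by apply/andP; split; rewrite -(ltr_pM2l b0).
rewrite iterSr (Tneg_eq _ 0) ?subr0; first by congr iter; lra.
by apply/andP; split; lra.
Qed.

Lemma frac_part_unique (t v w : R) : frac_part t v -> frac_part t w -> v = w.
Proof.
move=> [n [hn <-]] [k [hk <-]].
have [_ <-] := frac_part_shift n k t hn.
by have [_ <-] := frac_part_shift k n t hk; rewrite addnC.
Qed.

Lemma frac_part_mul (t v : R) : frac_part t v -> frac_part (- beta * t) (T v).
Proof.
have b0 : 0 < beta by have := beta_gt1; lra.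
move=> [n [hn <-]]; exists n.+1.
have -> : - beta * t / (- beta) ^+ n.+1 = t / (- beta) ^+ n.
  rewrite exprS -mulf_div divff ?mul1r //.
  by rewrite oppr_eq0 gt_eqF.
by rewrite iterS.
Qed.

Lemma frac_part_mulX (n : nat) (t v : R) :
  frac_part t v -> frac_part ((- beta) ^+ n * t) (iter n T v).
Proof.
elim: n => [|n ih] h; first by rewrite expr0 mul1r.
by rewrite exprS -mulrA iterS; apply/frac_part_mul/ih.
Qed.

Lemma frac_part_id (t : R) : l < t < r -> frac_part t t.
Proof. by move=> h; exists 0%N; rewrite expr0 divr1. Qed.

(** The point t / beta^2 lies in (l, r), and its first two digits are 0 and 1. *)
Lemma frac_part_sub1 (t : R) :
  r <= t < beta * (1 - r) -> t < 1 + r -> frac_part t (t - 1).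
Proof.
have b0 : 0 < beta by have := beta_gt1; lra.
have := lbetaE; have := mul_rbeta; have := rbeta_gt0; have := rbeta_lt1.
move=> e1 e2 e3 e4 /andP[h1 h2] h3.
set x := t / beta ^+ 2.
have ex : beta * (beta * x) = t by rewrite /x; field; rewrite gt_eqF.
have x0 : 0 < beta * x by rewrite -(ltr_pM2l b0) ex; lra.
have x1 : beta * x < 1 - r by rewrite -(ltr_pM2l b0) ex.
exists 2; rewrite sqrrN -/x; split.
  have xr : beta * x < beta * r by lra.
  have xp : 0 < x by rewrite -(ltr_pM2l b0) mulr0.
  by rewrite -[X in _ && X](ltr_pM2l b0) xr andbT; lra.
rewrite /= (Tneg_eq x 0) ?subr0; last by apply/andP; split; lra.
by rewrite (Tneg_eq _ 1); [lra | apply/andP; split; lra].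
Qed.

(** The excluded endpoint is reached through [l = - beta * r], as the fractional part of r is r - 1
    = l. *)
Lemma frac_part_l : frac_part l (T l).
Proof.
have b0 : 0 < beta by have := beta_gt1; lra.
have := lbetaE; have := mul_rbeta; have := rbeta_gt0; have := rbeta_lt1.
move=> e1 e2 e3 e4.
have rb : r < beta * r by rewrite -[X in X < _]mul1r ltr_pM2r.
have : frac_part r l.
  rewrite [X in frac_part _ X]e4; apply: frac_part_sub1; last by lra.
  by rewrite lexx /= mulrBr mulr1 e3; have := beta_gt1; lra.
by move/frac_part_mul; have -> : - beta * r = l by lra.
Qed.

(** * Membership in Z_{-beta} as vanishing of the fractional part *)

Lemma sum_digits (n : nat) (x : R) :
  \sum_(i < n) (expansion beta x (n.-1 - i))%:~R * (- beta) ^+ i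
    = (- beta) ^+ n * x - iter n T x.
Proof.
elim: n => [|n ih]; first by rewrite big_ord0 expr0 mul1r subrr.
rewrite big_ord_recl /= subn0 expr0 mulr1.
have -> : \sum_(i < n) (expansion beta x (n - bump 0 i))%:~R *
    (- beta) ^+ (bump 0 i) = - beta * ((- beta) ^+ n * x - iter n T x).
  rewrite -ih mulr_sumr; apply: eq_bigr => i _.
  rewrite /bump /= add1n exprS mulrCA; congr (_ * _).
  by have -> : (n - i.+1 = n.-1 - i)%N by lia.
by rewrite /expansion [T (iter _ _ _)]/Tneg exprS; ring.
Qed.

Lemma Zneg_frac_part (z : R) : Zneg beta z <-> frac_part z 0.
Proof.
have b0 : - beta != 0 by have := beta_gt1; rewrite oppr_eq0 => h; rewrite gt_eqF //; lra.
split=> [[a [a0 [_ [x hx ax]] ->]]|].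
  have da j : digit beta (iter j T (iter (size a) T x)) = 0.
    rewrite -iterD -/(expansion beta x (j + size a)) -ax /pad0.
    by rewrite nth_default // leq_addl.
  have x0 : iter (size a) T x = 0.
    by apply: eq0_of_digits0 da; exact: iter_Tneg_bounds.
  have -> : gamma beta a = (- beta) ^+ size a * x.
    rewrite -[RHS]subr0 -x0 -sum_digits; apply: eq_bigr => i _.
    rewrite nth_rev // -ax /pad0.
    by have -> : (size a - i.+1 = (size a).-1 - i)%N by lia.
  (* The admissible point may be l itself, which [frac_part] excludes; [frac_part_l] handles it. *)
  have := hx; rewrite /Ibeta /= le_eqVlt => /andP[/orP[/eqP e|h1] h2].
    rewrite -e; have := frac_part_mulX (size a) _ _ frac_part_l.
    by rewrite -iterSr iterS e x0 Tneg0.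
  by exists (size a); rewrite mulrC mulKf ?expf_neq0 // h1.
move=> [n0 [h0 e0]].
(* One additional digit makes the string nonempty even when [n0] is 0. *)
have [hx ex] := frac_part_shift n0 1 z h0; rewrite e0 in ex.
move: hx ex; rewrite addn1; set n := n0.+1; set x := z / _ => hx ex.
have hI : Ibeta beta x by rewrite /Ibeta /=; move/andP: hx => [/ltW-> ->].
have px : pad0 (mkseq (expansion beta x) n) = expansion beta x.
  apply: funext => i; rewrite /pad0; case: (ltnP i n) => hi.
    by rewrite nth_mkseq.
  rewrite nth_default ?size_mkseq // /expansion -(subnK hi) iterD ex.
  by rewrite iter_Tneg0 digit0.
exists (mkseq (expansion beta x) n); split.
- by rewrite -size_eq0 size_mkseq.
- split; last by exists x.
  by move=> i; rewrite px; apply/digit_alphabet/iter_Tneg_bounds.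
- have -> : z = (- beta) ^+ n * x - iter n T x.
    by rewrite ex subr0 /x mulrC divfK // expf_neq0.
  rewrite -sum_digits /gamma size_mkseq; apply: eq_bigr => i _.
  rewrite nth_rev ?size_mkseq // nth_mkseq /=; last by rewrite /n; lia.
  by have -> : (n - i.+1 = n.-1 - i)%N by lia.
Qed.

End Transformation.

Arguments frac_part {R} beta t v.

Lemma intr_close_eq (R : realDomainType) (i j : int) :
  j%:~R - 1 < i%:~R :> R -> i%:~R < j%:~R + 1 :> R -> j = i.
Proof.
by rewrite -(intrB R j 1) -(intrD R j 1) !ltr_int; lia.
Qed.

Lemma golden_bounds (R : realType) (x : R) :
  (1 + Num.sqrt 5) / 2 <= x -> 1 < x /\ x + 1 <= x * x.
Proof.
have s0 : 0 <= Num.sqrt 5 :> R by exact: sqrtr_ge0.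
have : (Num.sqrt 5 : R) ^+ 2 = 5 by rewrite sqr_sqrtr.
move: (Num.sqrt 5 : R) s0 => s s0 s5 hx.
have s1 : 1 < s by rewrite ltNge; apply/negP => h; nra.
by split; nra.
Qed.

(** * The orbit of the left endpoint and the intervals built from it *)

Section Gaps.
Context (R : realType) (beta : R) (m : nat) (d : nat -> int).
Hypothesis beta_golden : (1 + Num.sqrt 5) / 2 <= beta.
Hypothesis m_gt0 : (0 < m)%N.
Hypothesis expansion_l : forall i : nat, expansion beta (lbeta beta) i = d i.+1.
Hypothesis d_eq0 : forall j : nat, (m < j)%N -> d j = 0.
Hypothesis d_conds :
  forall i : nat, (1 <= i <= m)%N -> 0 < d i /\ d (2 * i)%N < d 1%N.

Local Notation l := (lbeta beta).
Local Notation r := (rbeta beta).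
Local Notation T := (Tneg beta).
Local Notation F := (frac_part beta).

Let beta_gt1 : 1 < beta. Proof. by have [] := golden_bounds R beta beta_golden. Qed.
Let beta_gt0 : 0 < beta. Proof. exact: lt_trans beta_gt1. Qed.
Let lE : l = r - 1. Proof. exact: lbetaE. Qed.
Let r_gt0 : 0 < r. Proof. exact: rbeta_gt0. Qed.
Let r_lt1 : r < 1. Proof. exact: rbeta_lt1. Qed.
Let mul_r : beta * r = 1 - r. Proof. exact: mul_rbeta. Qed.

Local Ltac blra := move: lE r_gt0 r_lt1 mul_r beta_gt1; lra.

Definition tau (k : nat) : R := iter k T l.
#[local] Arguments tau k : simpl never.

Lemma tauS (k : nat) : tau k.+1 = - beta * tau k - (d k.+1)%:~R.
Proof. by rewrite {1}/tau iterS {1}/Tneg -expansion_l. Qed.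

Lemma tau_bounds (k : nat) : l <= tau k < r.
Proof. by apply: iter_Tneg_bounds => //; rewrite lexx /= lE; blra. Qed.

Lemma tau_eq0 (k : nat) : (m <= k)%N -> tau k = 0.
Proof.
move=> hk; apply: (eq0_of_digits0 _ _ beta_gt1) (tau_bounds k) _ => j.
rewrite -iterD; have := expansion_l (j + k); rewrite /expansion => ->.
by apply: d_eq0; lia.
Qed.

(** If [tau k] were nonnegative, then [tau k.+1] would be at most -d_{k+1} <= -1 < l. *)
Lemma tau_lt0 (k : nat) : (k < m)%N -> tau k < 0.
Proof.
move=> hk; have [] := d_conds k.+1 _ => // d0 _.
have : 1 <= (d k.+1)%:~R :> R by rewrite ler1z.
have := tau_bounds k.+1; rewrite tauS => /andP[h _] h1.
rewrite ltNge; apply/negP => h2.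
have : 0 <= beta * tau k by exact: mulr_ge0 (ltW beta_gt0) h2.
blra.
Qed.

Lemma tau_le0 (k : nat) : tau k <= 0.
Proof. by have [/tau_eq0 ->|/tau_lt0/ltW] := leqP m k. Qed.

Lemma d_ge1 (k : nat) : (1 <= k <= m)%N -> 1 <= d k.
Proof. by move=> /d_conds[]. Qed.

(** The range reaches [m.+1] because flipping the link of odd index m involves the digit d_{m+1}. *)
Lemma d_even_lt (k : nat) : ~~ odd k -> (0 < k <= m.+1)%N -> d k <= d 1%N - 1.
Proof.
move=> ek hk; have [] := d_conds k./2 _; first by lia.
by rewrite mul2n even_halfK // => _; lia.
Qed.

(* From [a] to [b] the fractional part runs over [0, r), then over [l, u) and
   finally over (v, 0]; [w], equal to [u] or [v] in all uses, is its value at the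
   last discontinuity. *)
Definition gap (u v w a b : R) : Prop :=
  [/\ b = a + 1 + u - v,
      forall t, a <= t < a + r -> F t (t - a),
      forall t, a + r <= t < a + 1 + u -> F t (t - (a + 1)),
      F (a + 1 + u) w &
      forall t, a + 1 + u < t <= b -> F t (t - b)].

(** For k > 0 these two indices are k - 1 and k, sorted by parity. *)
Definition odd_index (k : nat) : nat := if odd k then k else k.-1.
Definition even_index (k : nat) : nat := if odd k then k.-1 else k.

Lemma even_index_ge (k : nat) :
  (0 < k <= m)%N -> (m <= even_index k)%N -> k = m.
Proof. by rewrite /even_index; case: (odd k); lia. Qed.

(** Taking [u = v = l] empties the middle piece, which leaves a unit interval. In [link_partial] the
    one-sided limits at the last discontinuity are the odd term of the orbit on the left and the
    even one on the right; the value there is [tau k], one of the two. *)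
Inductive link (a b : R) : Prop :=
| link_full of gap l l l a b
| link_partial k of (1 <= k <= m)%N &
    gap (tau (odd_index k)) (tau (even_index k)) (tau k) a b.

Inductive chain : R -> R -> Prop :=
| chain_nil a : chain a a
| chain_cons a c b of link a c & chain c b : chain a b.

Lemma chain_cat (a b c : R) : chain a b -> chain b c -> chain a c.
Proof. by elim=> // {}a p {}b h _ ih /ih; exact: chain_cons. Qed.

Lemma chain_link (a b : R) : link a b -> chain a b.
Proof. by move=> h; apply: chain_cons h (chain_nil _). Qed.

Lemma gap_full (a b : R) : b = a + 1 ->
  (forall t, a <= t < a + r -> F t (t - a)) ->
  (forall t, a + r <= t <= b -> F t (t - b)) -> gap l l l a b.
Proof.
move=> -> h1 h2; split=> //.
- by rewrite addrK.
- by move=> t /andP[? ?]; exfalso; blra.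
- have {2}-> : l = a + 1 + l - (a + 1) by ring.
  by apply: h2; apply/andP; split; rewrite lE; blra.
- by move=> t /andP[? ?]; apply: h2; apply/andP; split; blra.
Qed.

Lemma gap_full_right (a b : R) : gap l l l a b ->
  forall t, a + r <= t <= b -> F t (t - b).
Proof.
move=> [eb _ _ h1 h2] t /andP[]; have e : a + 1 + l = a + r by rewrite lE; ring.
rewrite le_eqVlt => /orP[/eqP <- _|*]; last by apply: h2; apply/andP; split; blra.
by rewrite e in h1; have -> : a + r - b = l by rewrite eb lE; ring.
Qed.

(** Equal one-sided limits mean that there is no jump: the last two pieces merge into that of a unit
    interval. *)
Lemma gap_diag (t a b : R) : l <= t <= 0 -> gap t t t a b -> link a b.
Proof.
move=> /andP[ht1 ht2] [eb h1 h2 h3 h4]; apply: link_full; apply: gap_full => //; first by blra.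
move=> s /andP[s1 s2]; have -> : b = a + 1 by blra.
case: (ltrgtP s (a + 1 + t)) => hs.
- by apply: h2; apply/andP; split.
- by have <- : b = a + 1 by [blra]; apply: h4; apply/andP; split.
- by rewrite hs; have -> : a + 1 + t - (a + 1) = t by ring.
Qed.

(** * Multiplication by -beta *)

(** The digit of [t - p] need not be computed: it is whichever integer [j] brings the result into
    [l, r). *)
Lemma frac_part_flip (p s : R) (j : int) (q := - beta * p + j%:~R) (t := - (s / beta)) :
  F t (t - p) -> l <= s - q < r -> F s (s - q).
Proof.
have e : - beta * t = s by rewrite /t mulrNN mulrC divfK // gt_eqF.
move=> /(frac_part_mul _ _ beta_gt1) h hs; move: h; rewrite e.
have e2 : - beta * (t - p) - j%:~R = s - q by rewrite /q -e; ring.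
by rewrite (Tneg_eq _ _ beta_gt1 _ j) e2.
Qed.

Lemma chain_run (D : R) (n0 n1 : int) : n0 <= n1 ->
  (forall s (j : int), D + n0%:~R <= s <= D + n1%:~R ->
     l <= s - (D + j%:~R) < r -> F s (s - (D + j%:~R))) ->
  chain (D + n0%:~R) (D + n1%:~R).
Proof.
move=> le01; have [k ->] : exists k : nat, n1 = n0 + k%:Z.
  by exists `|n1 - n0|%N; lia.
elim: k => [|k ih] h; first by rewrite addr0; exact: chain_nil.
rewrite -addn1 PoszD addrA !intrD in h *.
apply: (chain_cat _ (D + (n0%:~R + k%:~R))).
  rewrite -intrD; apply: ih => s j /andP[s1 s2] hs; apply: h hs.
  by rewrite s1 /=; move: s2; rewrite intrD; blra.
apply/chain_link/link_full/gap_full; first by rewrite !addrA.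
  move=> t /andP[t1 t2]; rewrite -!intrD; apply: h; rewrite ?intrD.
    by have : 0 <= k%:~R :> R by []; move=> ?; apply/andP; split; blra.
  by apply/andP; split; rewrite ?lE; blra.
move=> t /andP[t1 t2]; rewrite -!intrD; apply: h; rewrite ?intrD.
  by have : 0 <= k%:~R :> R by []; move=> ?; apply/andP; split; blra.
by apply/andP; split; rewrite ?lE; blra.
Qed.

Lemma tau1 : tau 1 = beta * (1 - r) - (d 1)%:~R.
Proof. by rewrite tauS -[tau 0]/l lE; ring. Qed.

(** This is the right end of every flipped gap. The point [D + d 1 + tau 1] is the image of [a + r];
    beyond it lies the image of the first piece, starting from l = [tau 0]. Hence the last link has
    index 1, and unit links precede it. *)
Lemma chain_tail (D A : R) (n0 : int) : n0 <= d 1%N - 1 ->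
  A = D + (d 1%N)%:~R + tau 1 - l ->
  (forall s (j : int), D + n0%:~R <= s <= D + (d 1%N)%:~R + tau 1 ->
     l <= s - (D + j%:~R) < r -> F s (s - (D + j%:~R))) ->
  (forall s, D + (d 1%N)%:~R + tau 1 < s <= A -> F s (s - A)) ->
  chain (D + n0%:~R) A.
Proof.
move=> hn eA h1 h2; have /andP[t1 t2] := tau_bounds 1.
have ed : (d 1%N - 1)%:~R = (d 1%N)%:~R - 1 :> R by rewrite intrB.
have hn' : n0%:~R <= (d 1%N)%:~R - 1 :> R by rewrite -ed ler_int.
apply: (chain_cat _ (D + (d 1%N - 1)%:~R)).
  apply: chain_run => // s j /andP[s1 s2]; apply: h1; rewrite ed in s2.
  by rewrite lE in t1; apply/andP; split; blra.
apply/chain_link/(link_partial _ _ 1); first by rewrite m_gt0.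
rewrite /odd_index /even_index /= -[tau 0]/l ed; split.
- by rewrite eA; ring.
- move=> s /andP[s1 s2]; rewrite -ed; apply: h1; rewrite ?ed; apply/andP; split; blra.
- move=> s /andP[s1 s2]; have -> : D + ((d 1)%:~R - 1) + 1 = D + (d 1)%:~R by ring.
  by apply: h1; apply/andP; split; blra.
- have {2}-> : tau 1 = D + ((d 1)%:~R - 1) + 1 + tau 1 - (D + (d 1)%:~R) by ring.
  by apply: h1; apply/andP; split; blra.
- by move=> s /andP[s1 s2]; apply: h2; apply/andP; split; blra.
Qed.

Lemma flip_le (s x : R) : (- (s / beta) <= x) = (- beta * x <= s).
Proof. by rewrite lerNl ler_pdivlMr // mulrC mulrN mulNr. Qed.

Lemma flip_ge (s x : R) : (x <= - (s / beta)) = (s <= - beta * x).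
Proof. by rewrite lerNr ler_pdivrMr // mulrC mulrN mulNr. Qed.

Lemma flip_lt (s x : R) : (- (s / beta) < x) = (- beta * x < s).
Proof. by rewrite ltNge flip_ge -ltNge. Qed.

Lemma flip_gt (s x : R) : (x < - (s / beta)) = (s < - beta * x).
Proof. by rewrite ltNge flip_le -ltNge. Qed.

Lemma frac_part_flip_left (a s : R) :
  (forall t, a <= t < a + r -> F t (t - a)) ->
  - beta * (a + r) < s <= - beta * a -> F s (s - - beta * a).
Proof.
move=> h /andP[s1 s2]; have := frac_part_flip a s 0; rewrite addr0; apply.
  by apply: h; rewrite flip_ge flip_lt s1 s2.
by move: lE mul_r => *; apply/andP; split; blra.
Qed.

Lemma chain_flip_full (a b : R) : gap l l l a b -> chain (- beta * b) (- beta * a).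
Proof.
move=> g; have h := gap_full_right _ _ g; case: g => eb h1 _ _ _.
have -> : - beta * b = - beta * b + 0%:~R by rewrite addr0.
have e : - beta * b + (d 1)%:~R + tau 1 = - beta * (a + r).
  by rewrite tau1 eb; ring.
apply: chain_tail; rewrite ?e ?addr0.
- by have := d_ge1 1; rewrite m_gt0 => /(_ isT); lia.
- by rewrite lE; blra.
- move=> s j /andP[s1 s2]; apply: frac_part_flip.
  by apply: h; rewrite flip_ge flip_le s1 s2.
- by move=> s; apply: frac_part_flip_left.
Qed.

(* [right_part] and [left_part] are the images of the last two pieces of the gap;
   they meet at the image of the last discontinuity, inside the gap of index
   k + 1.  If [e = m], the last piece is empty and so is [left_part]. *)
Lemma chain_flip_partial (o e k : nat) (a b : R) : (e <= m)%N ->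
  d o.+1 <= d 1%N - 1 ->
  (tau o.+1 = 0 -> tau k.+1 = 0) ->
  (e = m -> tau o.+1 = 0) ->
  ((e < m)%N -> forall x y,
     gap (tau e.+1) (tau o.+1) (tau k.+1) x y -> link x y) ->
  gap (tau o) (tau e) (tau k) a b -> chain (- beta * b) (- beta * a).
Proof.
move=> em do_ tk0 em0 mid [eb h1 h2 h3 h4].
set D := - beta * (a + 1); set B := - beta * b.
have eC : - beta * (a + 1 + tau o) = D + (d o.+1)%:~R + tau o.+1.
  by rewrite tauS /D; ring.
have eC' : - beta * (a + 1 + tau o) = B + (d e.+1)%:~R + tau e.+1.
  by rewrite tauS /B eb; ring.
have eA : - beta * (a + r) = D + (d 1%N)%:~R + tau 1 by rewrite tau1 /D; ring.
have FC : F (- beta * (a + 1 + tau o)) (tau k.+1) by exact: frac_part_mul h3.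
have /andP[to1 to2] := tau_bounds o.+1.
have /andP[te1 te2] := tau_bounds e.+1.
have /andP[t11 t12] := tau_bounds 1.
have to0 := tau_le0 o.+1; have te0 := tau_le0 e.+1.
have doR : (d o.+1)%:~R <= (d 1%N)%:~R - 1 :> R.
  by rewrite -(intrB R _ 1) ler_int.
have right_part s (j : int) : D + (d o.+1)%:~R + tau o.+1 < s <= D + (d 1%N)%:~R + tau 1 ->
    l <= s - (D + j%:~R) < r -> F s (s - (D + j%:~R)).
  move=> /andP[s1 s2]; apply: frac_part_flip; apply: h2.
  by rewrite flip_ge flip_lt eC eA s1 s2.
have left_part s (j : int) : B <= s < B + (d e.+1)%:~R + tau e.+1 ->
    l <= s - (B + j%:~R) < r -> F s (s - (B + j%:~R)).
  move=> /andP[s1 s2]; apply: frac_part_flip; apply: h4.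
  by rewrite flip_gt flip_le eC' s1 s2.
have tail : chain (D + (d o.+1)%:~R) (- beta * a).
  apply: chain_tail => //.
  - by rewrite -eA lE; blra.
  - move=> s j /andP[s1 s2] hs.
    have [sC|sC] := ltrP (D + (d o.+1)%:~R + tau o.+1) s.
      by apply: right_part => //; rewrite sC s2.
    (* As [tau o.+1 <= 0], such an s can only be the image of the last discontinuity, whose value
       [tau k.+1] vanishes by [tk0]. *)
    have tz : tau o.+1 = 0 by blra.
    have es : s = D + (d o.+1)%:~R by blra.
    have ej : j = d o.+1.
      by move: hs; rewrite es => /andP[j1 j2]; apply: (intr_close_eq R); blra.
    by rewrite ej es subrr -(tk0 tz); move: FC; rewrite eC tz addr0.
  - by move=> s; rewrite -eA; apply: frac_part_flip_left.
move: em; rewrite leq_eqVlt => /orP[/eqP em|em].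
  suff -> : B = D + (d o.+1)%:~R by [].
  have toz := em0 em; have tez : tau e.+1 = 0 by apply: tau_eq0; rewrite em.
  by move: eC eC'; rewrite toz tez (d_eq0 e.+1) ?em // => ->; rewrite !addr0 => ->.
have de : 1 <= d e.+1 by apply: d_ge1.
have ede : (d e.+1 - 1)%:~R = (d e.+1)%:~R - 1 :> R by rewrite intrB.
have deR : 1 <= (d e.+1)%:~R :> R by rewrite ler1z.
(* From left to right: unit links starting at [B], one link around the image of the last
   discontinuity, and [tail]. *)
apply: chain_cat _ tail.
apply: (chain_cat _ (B + (d e.+1 - 1)%:~R)).
  rewrite -{1}(addr0 B); apply: (chain_run B 0); first by rewrite subr_ge0.
  move=> s j /andP[s1 s2]; rewrite ede addr0 in s1 s2; apply: left_part.
  by apply/andP; split; blra.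
apply/chain_link/(mid em); rewrite ede; split.
- by blra.
- move=> s /andP[s1 s2]; rewrite -ede; apply: left_part; rewrite ?ede.
    by apply/andP; split; blra.
  by apply/andP; split; blra.
- move=> s /andP[s1 s2].
  have -> : B + ((d e.+1)%:~R - 1) + 1 = B + (d e.+1)%:~R by ring.
  by apply: left_part; apply/andP; split; blra.
- have -> : B + ((d e.+1)%:~R - 1) + 1 + tau e.+1 = - beta * (a + 1 + tau o) by blra.
  by [].
- move=> s /andP[s1 s2]; apply: right_part; apply/andP; split; blra.
Qed.

(** Reversing orientation swaps the one-sided limits, so the index pair (o, e) becomes (e + 1, o +
    1), the pair of index k + 1. At k = m the process stops: for odd m both new limits are 0 and
    [gap_diag] gives a unit link; for even m the last piece was empty and no middle link arises. *)
Lemma link_flip (a b : R) : link a b -> chain (- beta * b) (- beta * a).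
Proof.
case=> [|k /andP[k1 km]]; first exact: chain_flip_full.
rewrite /odd_index /even_index; case: ifP => ok.
- apply: chain_flip_partial; first by lia.
  + by apply: d_even_lt; [rewrite /= ok | lia].
  + by [].
  + by lia.
  + rewrite prednK // => _ x y g; have [km'|km'] := ltnP k m.
      by apply: (link_partial _ _ k.+1); rewrite // /odd_index /even_index /= ok.
    move: g; rewrite (tau_eq0 k) // (tau_eq0 k.+1) ?leqW //; apply: gap_diag.
    by apply/andP; split; rewrite ?lE; blra.
- apply: chain_flip_partial => //.
  + by rewrite prednK //; apply: d_even_lt; [rewrite ok | lia].
  + rewrite prednK // => h; have [?|/tau_lt0] := leqP m k; last by blra.
    by apply: tau_eq0; lia.
  + by move=> ->; rewrite prednK // tau_eq0.
  + move=> km' x y; rewrite prednK // => g.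
    by apply: (link_partial _ _ k.+1); rewrite // /odd_index /even_index /= ok.
Qed.

Lemma chain_flip (a b : R) : chain a b -> chain (- beta * b) (- beta * a).
Proof.
elim=> [{}a|{}a c {}b /link_flip h _ ih]; first exact: chain_nil.
exact: chain_cat ih h.
Qed.

(** * Chains covering the line *)

Lemma chain01 : chain 0 1.
Proof.
have [_ hg] := golden_bounds R beta beta_golden; move: (lE) (mul_r) => hl hr.
have g : 1 <= beta * (1 - r).
  have : r * (beta + 1) <= r * (beta * beta) by rewrite ler_pM2l.
  have -> : r * (beta * beta) = beta * (beta * r) by ring.
  by rewrite mulrDr mulrC hr; blra.
apply/chain_link/link_full/gap_full; first by rewrite add0r.
  rewrite add0r => t /andP[t1 t2]; rewrite subr0.
  by apply: frac_part_id; apply/andP; split; blra.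
rewrite add0r => t /andP[t1 t2].
have [t3|t3] := ltrP t (beta * (1 - r)).
  by apply: frac_part_sub1 => //; [apply/andP; split | blra].
(* This happens only for the golden ratio, where [1 = - beta * l] and [T l = 0]. *)
have et : t = 1 by blra.
have eb : beta * (1 - r) = 1 by blra.
have Tl : T l = 0.
  rewrite (Tneg_eq _ _ beta_gt1 _ 1); first by rewrite hl; blra.
  by rewrite hl; apply/andP; split; blra.
have := frac_part_mul _ _ beta_gt1 _ _ (frac_part_l _ _ beta_gt1).
by rewrite Tl (Tneg0 _ _ beta_gt1) et subrr (_ : - beta * l = 1) // hl; blra.
Qed.

Lemma chain_expr (n : nat) :
  if odd n then chain (- beta ^+ n) 0 else chain 0 (beta ^+ n).
Proof.
elim: n => [|n /=]; first by rewrite expr0; exact: chain01.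
by case: (odd n) => /chain_flip; rewrite mulr0 ?mulrNN ?mulNr exprS.
Qed.

(** * Zeros of the fractional part inside a link *)

Lemma link_ends (a b : R) : link a b -> [/\ F a 0, F b 0 & a <= b].
Proof.
case=> [|k /andP[k1 km]] [eb h1 _ h3 h4].
  split; last by rewrite eb; blra.
    by rewrite -(subrr a); apply: h1; apply/andP; split; blra.
  by rewrite -(subrr b); apply: h4; apply/andP; split; blra.
have /andP[t1 t2] := tau_bounds (odd_index k).
have /andP[e1 e2] := tau_bounds (even_index k).
have e0 := tau_le0 (even_index k).
split; last by rewrite eb; blra.
  by rewrite -(subrr a); apply: h1; apply/andP; split; blra.
have [h|h] := ltP (tau (even_index k)) 0.
  by rewrite -(subrr b); apply: h4; apply/andP; split; blra.
(* The last piece is empty, so b is the discontinuity itself, with value [tau m] = 0. *)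
have km' : k = m.
  have [|/tau_lt0 h'] := leqP m (even_index k); last by exfalso; lra.
  by apply: even_index_ge; rewrite k1.
rewrite km' (tau_eq0 m) // in h3.
by have -> : b = a + 1 + tau (odd_index m) by rewrite km' in eb e0 h; blra.
Qed.

(** Besides its ends, a link can contain a zero only at the last discontinuity, and only if [tau k]
    = 0, that is k = m. For even m this point is b; for odd m it is a + 1, which splits the link
    into lengths 1 and [- tau m.-1]. *)
Lemma link_consecutive (a b x y : R) : link a b -> a <= x -> y <= b ->
  consecutive (Zneg beta) x y ->
  y - x = 1 \/ exists k, [/\ (1 <= k <= m)%N &
    y - x = if (k == m) && odd m then - tau m.-1
            else 1 + tau (odd_index k) - tau (even_index k)].
Proof.
move=> lk ax yb [/(Zneg_frac_part _ _ beta_gt1) zx /(Zneg_frac_part _ _ beta_gt1) zy xy nz].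
have [Fa Fb ab] := link_ends _ _ lk.
have uniq := frac_part_unique _ _ beta_gt1.
case: lk => [g|k km g].
  have h2 := gap_full_right _ _ g; case: g => eb h1 _ _ _.
  have zero z : a <= z <= b -> F z 0 -> z = a \/ z = b.
    move=> /andP[z1 z2] Fz; have [h|h] := ltP z (a + r).
      by left; have := uniq _ _ _ Fz (h1 z _); rewrite z1 h => /(_ isT); blra.
    by right; have := uniq _ _ _ Fz (h2 z _); rewrite z2 h => /(_ isT); blra.
  left; have [] := zero x _ zx; first by apply/andP; split; blra.
    by have [] := zero y _ zy; [apply/andP; split; blra | blra | blra].
  by blra.
case: g => eb h1 h2 h3 h4.
have o0 := tau_le0 (odd_index k).
have zero z : a <= z <= b -> F z 0 ->
    [\/ z = a, z = a + 1 + tau (odd_index k) /\ tau k = 0 | z = b].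
  move=> /andP[z1 z2] Fz; have [h|h] := ltP z (a + r).
    by apply: Or31; have := uniq _ _ _ Fz (h1 z _); rewrite z1 h => /(_ isT); blra.
  have [h'|h'|h'] := ltrgtP z (a + 1 + tau (odd_index k)).
  - by have := uniq _ _ _ Fz (h2 z _); rewrite h h' => /(_ isT); blra.
  - by apply: Or33; have := uniq _ _ _ Fz (h4 z _); rewrite z2 h' => /(_ isT); blra.
  - by apply: Or32; split=> //; rewrite h' in Fz; exact: uniq h3 Fz.
have {}zx : [\/ x = a, x = a + 1 + tau (odd_index k) /\ tau k = 0 | x = b].
  by apply: zero zx; apply/andP; split; blra.
have {}zy : [\/ y = a, y = a + 1 + tau (odd_index k) /\ tau k = 0 | y = b].
  by apply: zero zy; apply/andP; split; blra.
have [/andP[/eqP km' om]|nkm] := boolP ((k == m) && odd m).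
  have eo : odd_index k = m by rewrite /odd_index km' om.
  have ee : even_index k = m.-1 by rewrite /even_index km' om.
  rewrite eo (tau_eq0 m) // in zx zy h3; rewrite eo ee (tau_eq0 m) // in eb.
  have t0 : tau m.-1 < 0 by apply: tau_lt0; rewrite ltn_predL.
  have Z1 : Zneg beta (a + 1).
    apply/(Zneg_frac_part _ _ beta_gt1); move: h3.
    by rewrite km' (tau_eq0 m) // addr0.
  have xyz := nz _ Z1.
  case: zx => [ex|[ex _]|ex]; case: zy => [ey|[ey _]|ey];
    try by exfalso; lra.
  - by left; blra.
  - by right; exists m; split; [rewrite m_gt0 leqnn | rewrite eqxx om /= ex ey eb; ring].
have cb : tau k = 0 -> a + 1 + tau (odd_index k) = b.
  move=> tk0; have km' : k = m.
    have [mk|/tau_lt0 h] := leqP m k; last by exfalso; lra.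
    by apply/eqP; rewrite eqn_leq mk; case/andP: km => _ ->.
  rewrite eb km' /even_index; move: nkm; rewrite km' eqxx /= => /negPf->.
  by rewrite (tau_eq0 m) // subr0.
right; exists k; split=> //; rewrite (negPf nkm).
by case: zx => [ex|[ex /cb ec]|ex]; case: zy => [ey|[ey /cb ec']|ey]; blra.
Qed.


(** The points where links meet are zeros, so no consecutive pair straddles one. *)
Lemma chain_consecutive (a b x y : R) : chain a b -> a <= x -> y <= b ->
  consecutive (Zneg beta) x y -> exists p q, [/\ link p q, p <= x & y <= q].
Proof.
move=> h ax yb cxy; elim: h ax yb => [c|p c q lk _ ih] px yq.
  by case: cxy => _ _ xy _; exfalso; lra.
have [cx|xc] := leP c x; first exact: ih.
exists p, c; split=> //; rewrite leNgt; apply/negP => cy.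
have [_ Fc _] := link_ends _ _ lk; have [_ _ _] := cxy.
by move=> /(_ c); rewrite xc cy; apply=> //; apply/Zneg_frac_part.
Qed.

Lemma chain_covers (x y : R) : x < y -> (0 <= x) || (y <= 0) ->
  exists a b, [/\ chain a b, a <= x & y <= b].
Proof.
move=> xy h.
have [n hn] := exists_expr_gt _ _ beta_gt1 (`|x| + `|y|).
have [x1 x2] := (ler_norm x, ler_norm (- x)).
have [y1 y2] := (ler_norm y, ler_norm (- y)); rewrite !normrN in x2 y2.
(* The parity of the exponent selects the half-line that is covered. *)
have [k [nk ok]] : exists k, (n <= k)%N /\ odd k = (y <= 0).
  exists (n.*2 + (y <= 0)%R)%N; split; first by rewrite -addnn -addnA leq_addr.
  by rewrite oddD odd_double; case: (y <= 0).
have := chain_expr k; have {}hn := hn k nk; rewrite ok.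
case: (leP y 0) h => [y0 _|y0 x0] hc.
  by exists (- beta ^+ k), 0; split=> //; lra.
by rewrite orbF in x0; exists 0, (beta ^+ k); split=> //; lra.
Qed.

(** * Identification of the lengths with Delta_k *)

(** The sum telescopes through d_{j+1} = -beta tau_j - tau_{j+1}. *)
Lemma sum_digit_differences (k n : nat) :
  \sum_(1 <= i < n.+1) ((d (k + i)%N - d (k.+1 + i)%N)%:~R / (- beta) ^+ i)
    = tau k - tau k.+1 - (tau (k + n) - tau (k.+1 + n)) / (- beta) ^+ n.
Proof.
have b0 : - beta != 0 by rewrite oppr_eq0 gt_eqF.
elim: n => [|n ih]; first by rewrite big_geq // !addn0 expr0 divr1 subrr.
rewrite big_nat_recr //= ih !addnS intrB -addrA; congr (_ + _).
have P0 : (- beta) ^+ n != 0 by rewrite expf_neq0.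
have d1 : (d (k + n).+1)%:~R = - beta * tau (k + n) - tau (k + n).+1.
  by rewrite tauS; ring.
have d2 : (d (k.+1 + n).+1)%:~R = - beta * tau (k.+1 + n) - tau (k.+1 + n).+1.
  by rewrite tauS; ring.
rewrite d1 d2 exprS; move: (- beta) ((- beta) ^+ n) b0 P0 => c P c0 P0.
by field; rewrite c0 P0.
Qed.

Lemma tau_pred : tau m.-1 = - ((d m)%:~R / beta).
Proof.
have := tauS m.-1; rewrite prednK // (tau_eq0 m) // => h.
have e : beta * tau m.-1 = - (d m)%:~R by lra.
by rewrite -mulNr -e mulrC mulKf // gt_eqF.
Qed.

Lemma Delta_initE (k : nat) : (0 < k <= m)%N ->
  Delta_init beta m d k = if (k == m) && odd m then - tau m.-1
    else 1 + tau (odd_index k) - tau (even_index k).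
Proof.
case: k => // k /= km; rewrite /Delta_init /=.
have [eq_km|ne_km] := eqVneq k.+1 m.
  rewrite eq_km ltnn /odd_index /even_index /= tau_pred opprK.
  by case: (odd m) => //; rewrite tau_pred (tau_eq0 m) // subr0.
rewrite ltn_neqAle ne_km km /=.
have -> : \big[+%R/0]_(1 <= i <oo)
    ((d (k.+1 - 1 + i)%N - d (k.+1 + i)%N)%:~R / (- beta) ^+ i) = tau k - tau k.+1.
  (* Beyond m the remainder involves only vanishing terms of the orbit, so the partial sums are
     constant. *)
  apply: lim_near_cst => //; exists m.+1 => // n /= mn.
  have := leq_trans (ltn0Sn m) mn; case: n mn => // n mn _.
  rewrite subn1 sum_digit_differences (tau_eq0 (k + n)) ?(tau_eq0 (k.+1 + n)).
  - by rewrite subrr mul0r subr0.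
  - by rewrite (leq_trans _ (leq_addl _ _)).
  - by rewrite (leq_trans _ (leq_addl _ _)).
(* Two points of [l, r) differ by less than 1, so (-1)^k fixes the sign inside the absolute
   value. *)
have /andP[t1 t2] := tau_bounds k; have /andP[t3 t4] := tau_bounds k.+1.
rewrite /odd_index /even_index /= -signr_odd /=.
case: (odd k) => /=; rewrite ?expr0 ?expr1.
  by rewrite ger0_norm; blra.
by rewrite ler0_norm; blra.
Qed.

Lemma consecutive_Delta (x y : R) : consecutive (Zneg beta) x y ->
  (exists k : nat, y - x = Delta beta m d k) /\ y - x < 2.
Proof.
move=> cxy; have [_ _ xy nz] := cxy.
have Z0 : Zneg beta 0.
  by apply/(Zneg_frac_part _ _ beta_gt1)/frac_part_id; apply/andP; split; blra.
(* No consecutive pair straddles 0, itself an element of the set. *)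
have side : (0 <= x) || (y <= 0).
  by case: leP => //= x0; rewrite leNgt; apply/negP => y0; apply: nz Z0 _; rewrite x0.
have [a [b [hc ax yb]]] := chain_covers _ _ xy side.
have [p [q [lk px yq]]] := chain_consecutive _ _ _ _ hc ax yb cxy.
have [e1|[k [km e]]] := link_consecutive _ _ _ _ lk px yq cxy.
  by split; [exists 0%N; rewrite e1 | lra].
split; first by exists k; rewrite e -Delta_initE // /Delta; case/andP: km => _ ->.
(* The bound 2 follows from [tau <= 0] at the odd index and [tau >= l > -1] elsewhere. *)
rewrite e; have /andP[h1 h2] := tau_bounds m.-1.
have h3 := tau_le0 (odd_index k); have /andP[h4 h5] := tau_bounds (even_index k).
by case: ifP => _; blra.
Qed.

End Gaps.

Theorem theorem5p10 (R : realType) (beta : R) (m : nat) (d : nat -> int)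
    (hbeta : (1 + Num.sqrt 5) / 2 <= beta)
    (hm : (1 <= m)%N)
    (hexp : forall i : nat, expansion beta (lbeta beta) i = d i.+1)
    (hzero : forall j : nat, (m < j)%N -> d j = 0)
    (hdm : d m <> 0)
    (hd : forall i : nat, (1 <= i <= m)%N -> 0 < d i /\ d (2 * i)%N < d 1%N) :
  forall x y : R, consecutive (Zneg beta) x y ->
    (exists k : nat, y - x = Delta beta m d k) /\ y - x < 2.
Proof. by move=> x y; apply: consecutive_Delta. Qed.
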